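(* Let $b>1$ be real. Then $$\pi=\frac{2b^4(b^2-1)}{1+b^2}\;\frac{K\!\left(\dfrac{2b}{1+b^2}\right)}{b^4+(1-b^2)\,F_1\!\left(\tfrac32;1,\tfrac12;2\,\Big|\,\dfrac1{b^2},\dfrac1{b^4}\right)}.$$
   Context: $K(k)=\int_0^1\frac{dx}{\sqrt{(1-x^2)(1-k^2x^2)}}$ is the complete elliptic integral of the first kind, as a function of the modulus $k$. The two-variable Appell function is $F_1(\alpha;\beta_1,\beta_2;\gamma\,|\,x,y)=\sum_{m,n\ge0}\frac{(\alpha)_{m+n}(\beta_1)_m(\beta_2)_n}{(\gamma)_{m+n}\,m!\,n!}x^my^n$ for $|x|,|y|<1$, with $(x)_k$ the Pochhammer symbol. For $\operatorname{Re}\gamma>\operatorname{Re}\alpha>0$ it equals, and outside the region of convergence is defined by analytic continuation through, $\frac{\Gamma(\gamma)}{\Gamma(\alpha)\Gamma(\gamma-\alpha)}\int_0^1\frac{u^{\alpha-1}(1-u)^{\gamma-\alpha-1}}{(1-xu)^{\beta_1}(1-yu)^{\beta_2}}\,du$ (principal branches, $x,y\notin[1,\infty)$). *)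

(* Defs.v *)
From Stdlib Require Import Reals Factorial.
From Coquelicot Require Import Coquelicot.
Open Scope R_scope.

(** The integrand is singular at [x = 1], so the integral is an improper
    Riemann integral, with upper endpoint approached from the left; the
    argument is the modulus [k], not the parameter [k ^ 2]. *)
Definition ellipticK (k : R) : R :=
  RInt_gen (fun x : R => / sqrt ((1 - x ^ 2) * (1 - k ^ 2 * x ^ 2)))
    (at_point 0) (at_left 1).

(** Rising factorial [a (a + 1) ... (a + n - 1)]. *)
Fixpoint pochhammer (a : R) (n : nat) : R :=
  match n with
  | O => 1
  | S m => pochhammer a m * (a + INR m)
  end.

(** Only meant for [Rabs x < 1] and [Rabs y < 1], with [c] not a nonpositive
    integer. There the double series converges absolutely, hence equals the
    iterated sum below; there is no analytic continuation outside. *)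
Definition appellF1 (a b1 b2 c x y : R) : R :=
  Series (fun m : nat => Series (fun n : nat =>
    pochhammer a (m + n) * pochhammer b1 m * pochhammer b2 n
      / (pochhammer c (m + n) * INR (fact m) * INR (fact n))
      * x ^ m * y ^ n)).

(* Main.v *)
Require Import Defs.
From Stdlib Require Import Reals Factorial Lra Lia.
From Coquelicot Require Import Coquelicot.
Open Scope R_scope.

(** Put [q = 1 / b ^ 2] and let [a n = (1/2)_n / n!] be the coefficients of
    [(1 - z)^(-1/2)] ([invsqrt_coeff]). Both special values in the theorem are
    governed by the power series of that function, through
    [A = sum_n (a n * q ^ n) ^ 2].

    The Appell function. As [(3/2)_N / (2)_N = 2 * a (N + 1)] and
    [(1)_m / m! = 1], [q * F1] is twice the sum over [i > j] of
    [a i * a j * q ^ (i + j)] ([appellF1_diagonal]). Hence [A + q * F1] is the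
    full double sum, that is the square of [sum_i a i * q ^ i]
    ([Series_sqr_diagonals]), which is [1 / (1 - q)] ([invsqrt_series_sqr]).
    So the denominator [b ^ 4 + (1 - b ^ 2) * F1] equals [b ^ 4 * (1 - q) * A].

    The elliptic integral. The modulus [k = 2 * b / (1 + b ^ 2)] satisfies
    [k ^ 2 = 4 * q / (1 + q) ^ 2]; with [x = sin t],
<<
  1 - k^2 sin^2 t = (1 + 2 q cos 2t + q^2) / (1 + q)^2 = |1 - z|^2 / (1 + q)^2,
  z = - q e^(2it).
>>
    The integrand is therefore [(1 + q) * |(1 - z)^(-1/2)| ^ 2]
    ([invsqrt_modulus]), and Parseval's formula on [0, PI/2] gives
    [K(k) = (1 + q) * (PI / 2) * A] ([ellipticK_landen_series]). This is Landen's
    transformation and the power series of [K] obtained in one stroke. In the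
    quotient [A] cancels and only [PI] remains. *)

(** * Absolutely convergent real series *)

Lemma ex_series_dominated (a b : nat -> R) :
  (forall n, Rabs (a n) <= b n) -> ex_series b -> ex_series (fun n => Rabs (a n)).
Proof.
intros Hab. apply (ex_series_le (V := R_CompleteNormedModule)).
intros n. change norm with Rabs. now rewrite Rabs_Rabsolu.
Qed.

Lemma ex_series_mul_bounded (w u : nat -> R) :
  ex_series (fun n => Rabs (w n)) -> (forall n, Rabs (u n) <= 1) ->
  ex_series (fun n => Rabs (w n * u n)).
Proof.
intros Hw Hu. apply ex_series_dominated with (2 := Hw). intros n.
rewrite Rabs_mult. rewrite <- (Rmult_1_r (Rabs (w n))) at 2.
apply Rmult_le_compat_l; [apply Rabs_pos|auto].
Qed.

Lemma ex_series_geom_abs (r : R) : Rabs r < 1 -> ex_series (fun n => Rabs (r ^ n)).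
Proof.
intros Hr. apply ex_series_ext with (fun n => Rabs r ^ n).
- intros n. apply RPow_abs.
- exists (/ (1 - Rabs r)). apply is_series_geom. now rewrite Rabs_Rabsolu.
Qed.

Definition tail (p : nat -> R) (n : nat) : R := Series (fun k => p (n + k)%nat).

Lemma tail_S p n : ex_series p -> tail p n = p n + tail p (S n).
Proof.
intros Hp. unfold tail. rewrite Series_incr_1.
- rewrite Nat.add_0_r. f_equal. apply Series_ext; intros; f_equal; lia.
- now apply -> (ex_series_incr_n (V := R_NormedModule)).
Qed.

Lemma sum_n_tail p N : ex_series p -> Series p - sum_n p N = tail p (S N).
Proof.
intros Hp. rewrite (Series_incr_n p (S N)) by (lia || assumption).
rewrite sum_n_Reals. simpl. unfold tail. simpl. ring.
Qed.

Lemma tail_nonneg p n : (forall n, 0 <= p n) -> ex_series p -> 0 <= tail p n.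
Proof.
intros Hpos Hp. unfold tail. rewrite <- (Rmult_0_l (Series (fun k => p (n + k)%nat))).
rewrite <- Series_scal_l. apply Series_le.
- intros k. specialize (Hpos (n + k)%nat). lra.
- now apply -> (ex_series_incr_n (V := R_NormedModule)).
Qed.

Lemma tail_le p m n : (forall n, 0 <= p n) -> ex_series p -> (m <= n)%nat ->
  tail p n <= tail p m.
Proof.
intros Hpos Hp Hmn. induction Hmn; [lra|].
rewrite (tail_S p m0) in IHHmn by assumption. specialize (Hpos m0). lra.
Qed.

Lemma is_lim_seq_tail p : ex_series p -> is_lim_seq (tail p) 0.
Proof.
intros Hp. apply is_lim_seq_incr_1.
apply is_lim_seq_ext with (fun N => Series p - sum_n p N).
- intros; now apply sum_n_tail.
- replace (Finite 0) with (Rbar_minus (Series p) (Series p))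
    by (simpl; f_equal; ring).
  apply is_lim_seq_minus'; [apply is_lim_seq_const|].
  exact (Series_correct _ Hp).
Qed.

Lemma is_series_telescope (f v : nat -> R) :
  (forall n, f n = v n - v (S n)) -> is_lim_seq v 0 -> is_series f (v 0%nat).
Proof.
intros Hf Hv. change (is_lim_seq (sum_n f) (v 0%nat)).
apply is_lim_seq_ext with (fun N => v 0%nat - v (S N)).
- induction n as [|n IH].
  + rewrite sum_O. now rewrite Hf.
  + rewrite sum_Sn, <- IH, Hf. unfold plus; simpl; ring.
- replace (Finite (v 0%nat)) with (Finite (v 0%nat - 0)) by (f_equal; ring).
  apply is_lim_seq_minus'; [apply is_lim_seq_const|].
  now apply is_lim_seq_incr_1 in Hv.
Qed.

Lemma ex_series_sqr (w : nat -> R) :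
  ex_series (fun n => Rabs (w n)) -> ex_series (fun n => w n ^ 2).
Proof.
intros Hw. set (T := tail (fun n => Rabs (w n))).
apply ex_series_Rabs, ex_series_dominated with (fun n => Rabs (w n) * T 0%nat);
  [|now apply ex_series_scal_r].
intros n. rewrite <- RPow_abs.
assert (Hn : Rabs (w n) <= T 0%nat).
{ apply Rle_trans with (T n).
  - unfold T. rewrite tail_S by assumption.
    pose proof (tail_nonneg _ (S n) (fun i => Rabs_pos (w i)) Hw); lra.
  - apply tail_le; [intros; apply Rabs_pos|assumption|lia]. }
pose proof (Rabs_pos (w n)). nra.
Qed.

(** * The Taylor coefficients of the inverse square root *)

Definition invsqrt_coeff (n : nat) : R := pochhammer (1 / 2) n / INR (fact n).

Lemma invsqrt_coeff_S n :
  (INR n + 1) * invsqrt_coeff (S n) = (INR n + 1 / 2) * invsqrt_coeff n.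
Proof.
unfold invsqrt_coeff; rewrite fact_simpl, mult_INR, S_INR; simpl pochhammer.
pose proof (pos_INR n); pose proof (INR_fact_neq_0 n); field; lra.
Qed.

Lemma invsqrt_coeff_bounds n : 0 < invsqrt_coeff n <= 1.
Proof.
induction n as [|n IH].
- unfold invsqrt_coeff; simpl; lra.
- pose proof (invsqrt_coeff_S n) as E; pose proof (pos_INR n) as Hn.
  split; nra.
Qed.

(** The weights of [k] and [N - k] average to [N / 2], and the rest of the summand
    is symmetric under [k -> N - k]. *)
Lemma index_weighted_convolution (a : nat -> R) (N : nat) :
  sum_f_R0 (fun k => INR k * (a k * a (N - k)%nat)) N
  = INR N / 2 * sum_f_R0 (fun k => a k * a (N - k)%nat) N.
Proof.
set (w := fun k => INR k * (a k * a (N - k)%nat)).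
assert (Hrev : sum_f_R0 w N
  = sum_f_R0 (fun k => INR (N - k) * (a k * a (N - k)%nat)) N).
{ rewrite <- (sum_f_R0_skip w). apply sum_eq; intros i Hi; unfold w.
  replace (N - (N - i))%nat with i by lia. ring. }
assert (Hsum : sum_f_R0 w N + sum_f_R0 w N
  = INR N * sum_f_R0 (fun k => a k * a (N - k)%nat) N).
{ rewrite Hrev at 2. rewrite <- plus_sum, scal_sum.
  apply sum_eq; intros i Hi; unfold w. rewrite minus_INR by lia. ring. }
lra.
Qed.

(** This is [(1 - z)^(-1/2) * (1 - z)^(-1/2) = 1 / (1 - z)] read off on
    coefficients. With [S N] the left side, evaluate [sum_j j a_j a_(N+1-j)] in two
    ways: by symmetry it is [(N + 1) / 2 * S (N + 1)], and by the recurrence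
    [(k + 1) a_(k+1) = (k + 1/2) a_k] it is [(N + 1) / 2 * S N]. So [S] is
    constant. *)
Lemma invsqrt_coeff_convolution N :
  sum_f_R0 (fun k => invsqrt_coeff k * invsqrt_coeff (N - k)) N = 1.
Proof.
set (a := invsqrt_coeff).
induction N as [|N IH].
- unfold a, invsqrt_coeff; simpl; field.
- pose proof (index_weighted_convolution a N) as EN.
  pose proof (index_weighted_convolution a (S N)) as ESN.
  rewrite decomp_sum in ESN by lia; simpl Init.Nat.pred in ESN.
  rewrite (sum_eq _ (fun k => INR k * (a k * a (N - k)%nat)
             + (a k * a (N - k)%nat) * (1 / 2))) in ESN.
  2:{ intros i Hi. replace (S N - S i)%nat with (N - i)%nat by lia.
      rewrite S_INR. pose proof (invsqrt_coeff_S i) as E; fold a in E.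
      transitivity ((INR i + 1) * a (S i) * a (N - i)%nat); [ring|].
      rewrite E; ring. }
  rewrite plus_sum, <- scal_sum, EN, IH in ESN.
  rewrite S_INR in ESN; simpl INR in ESN. pose proof (pos_INR N).
  apply (Rmult_eq_reg_l ((INR N + 1) / 2)); lra.
Qed.

Lemma ex_series_invsqrt (r : R) : Rabs r < 1 ->
  ex_series (fun n => Rabs (invsqrt_coeff n * r ^ n)).
Proof.
intros Hr. apply ex_series_ext with (fun n => Rabs (r ^ n * invsqrt_coeff n)).
- intros n; now rewrite Rmult_comm.
- apply ex_series_mul_bounded; [now apply ex_series_geom_abs|].
  intros n. pose proof (invsqrt_coeff_bounds n). rewrite Rabs_pos_eq; lra.
Qed.

(** Cauchy product with bounded twists [u] and [v]: taking [u], [v] among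
    [cos (2 n x)] and [sin (2 n x)] gives the real and imaginary parts of the square
    of [sum_n a_n (r e^(2ix))^n] without complex numbers. *)
Lemma is_series_invsqrt_mult (r : R) (u v : nat -> R) :
  Rabs r < 1 -> (forall n, Rabs (u n) <= 1) -> (forall n, Rabs (v n) <= 1) ->
  is_series
    (fun N => r ^ N * sum_f_R0 (fun k =>
       invsqrt_coeff k * invsqrt_coeff (N - k) * (u k * v (N - k)%nat)) N)
    (Series (fun n => invsqrt_coeff n * r ^ n * u n) *
     Series (fun n => invsqrt_coeff n * r ^ n * v n)).
Proof.
intros Hr Hu Hv.
pose proof (ex_series_mul_bounded _ u (ex_series_invsqrt r Hr) Hu) as Eu.
pose proof (ex_series_mul_bounded _ v (ex_series_invsqrt r Hr) Hv) as Ev.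
eapply is_series_ext;
  [| apply (is_series_mult _ _ _ _
       (Series_correct _ (ex_series_Rabs _ Eu))
       (Series_correct _ (ex_series_Rabs _ Ev)) Eu Ev)].
intros N; simpl. rewrite scal_sum. apply sum_eq; intros i Hi.
replace (r ^ N) with (r ^ i * r ^ (N - i))
  by (rewrite <- pow_add; f_equal; lia). ring.
Qed.

Lemma invsqrt_series_sqr (q : R) : Rabs q < 1 ->
  Series (fun n => invsqrt_coeff n * q ^ n) ^ 2 = / (1 - q).
Proof.
intros Hq.
assert (H1 : forall n : nat, Rabs ((fun _ : nat => 1) n) <= 1)
  by (intros; rewrite Rabs_R1; lra).
pose proof (is_series_invsqrt_mult q _ _ Hq H1 H1) as H.
apply is_series_unique in H.
rewrite (Series_ext _ (fun n => q ^ n)) in H.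
2:{ intros n. rewrite (sum_eq _ (fun k => invsqrt_coeff k * invsqrt_coeff (n - k)))
      by (intros; ring). rewrite invsqrt_coeff_convolution; ring. }
rewrite (is_series_unique _ _ (is_series_geom q Hq)) in H.
rewrite H, (Series_ext _ (fun n => invsqrt_coeff n * q ^ n * 1))
  by (intros; ring). ring.
Qed.

(** * The Appell function as an off-diagonal sum *)

(** The square of a series split along the diagonals [i - j = 0] and
    [i - j = m + 1]. Both summations telescope in the tails [T]: over [n], because
    [p n ^ 2 + 2 * p n * T (n + 1) = T n ^ 2 - T (n + 1) ^ 2]; over [m], because
    [p (n + m + 1) = T (n + m + 1) - T (n + m + 2)]. So no rearrangement
    of a double series is involved. *)
Lemma Series_sqr_diagonals (p : nat -> R) :
  (forall n, 0 <= p n) -> ex_series p ->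
  Series p ^ 2 = Series (fun n => p n ^ 2)
    + 2 * Series (fun m => Series (fun n => p (m + n + 1)%nat * p n)).
Proof.
intros Hpos Hp.
pose (T := tail p).
assert (HT : forall n, T n = p n + T (S n)) by (intros; now apply tail_S).
assert (HT0 : forall n, 0 <= T n) by (intros; now apply tail_nonneg).
assert (HTle : forall m n, (m <= n)%nat -> T n <= T m)
  by (intros; now apply tail_le).
assert (HlT : is_lim_seq T 0) by now apply is_lim_seq_tail.
assert (ET0 : T 0%nat = Series p) by (apply Series_ext; reflexivity).
assert (HexV : forall m, ex_series (fun n => p n * T (n + m)%nat)).
{ intros m. apply ex_series_Rabs, ex_series_dominated with (fun n => p n * T 0%nat).
  - intros n. rewrite Rabs_pos_eq by (apply Rmult_le_pos; auto).
    apply Rmult_le_compat_l; auto. apply HTle; lia.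
  - now apply ex_series_scal_r. }
(* V m adds up the pairs of indices at distance more than m. *)
pose (V := fun m => Series (fun n => p n * T (n + (m + 1))%nat)).
assert (HV : is_lim_seq V 0).
{ apply is_lim_seq_le_le with (fun _ => 0) (fun m => Series p * T m).
  - intros m; split; unfold V.
    + rewrite <- (Rmult_0_l (Series p)), <- Series_scal_l.
      apply Series_le; [|apply HexV].
      intros n; specialize (Hpos n); specialize (HT0 (n + (m + 1))%nat); nra.
    + rewrite <- Series_scal_r. apply Series_le; [|now apply ex_series_scal_r].
      intros n; split; [apply Rmult_le_pos; auto|].
      apply Rmult_le_compat_l; auto. apply HTle; lia.
  - apply is_lim_seq_const.
  - replace (Finite 0) with (Rbar_mult (Series p) 0)
      by (simpl; f_equal; ring).
    now apply is_lim_seq_scal_l. }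
assert (HD : Series (fun m => Series (fun n => p (m + n + 1)%nat * p n)) = V 0%nat).
{ apply is_series_unique, is_series_telescope; auto.
  intros m. unfold V. rewrite <- Series_minus by apply HexV.
  apply Series_ext; intros n.
  replace (n + (S m + 1))%nat with (S (n + (m + 1))) by lia.
  rewrite (HT (n + (m + 1))%nat).
  replace (n + (m + 1))%nat with (m + n + 1)%nat by lia. ring. }
rewrite HD. unfold V. rewrite <- Series_scal_l, <- Series_plus.
2:{ apply ex_series_sqr, ex_series_ext with p; auto.
    intros n; now rewrite Rabs_pos_eq. }
2:{ apply (ex_series_scal_l (V := R_NormedModule)), HexV. }
symmetry. rewrite <- ET0. apply is_series_unique.
apply (is_series_telescope _ (fun n => T n ^ 2)).
- intros n. rewrite (HT n). replace (n + (0 + 1))%nat with (S n) by lia. ring.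
- replace (Finite 0) with (Finite (0 * 0)) by (f_equal; ring).
  apply is_lim_seq_ext with (fun n => T n * T n); [intros; ring|].
  now apply is_lim_seq_mult'.
Qed.

Lemma pochhammer_one n : pochhammer 1 n = INR (fact n).
Proof.
induction n as [|n IH]; [reflexivity|].
rewrite fact_simpl, mult_INR, S_INR; simpl; rewrite IH; ring.
Qed.

Lemma pochhammer_shift a n : a * pochhammer (a + 1) n = pochhammer a (S n).
Proof.
induction n as [|n IH]; [simpl; ring|].
change (a * (pochhammer (a + 1) n * (a + 1 + INR n))
  = pochhammer a (S n) * (a + INR (S n))).
rewrite <- IH, S_INR. ring.
Qed.

(** With [i = m + n + 1] and [j = n], the exponent [m + 2 n] of [q] in the Appell
    series is [i + j - 1]; this is where the factor [q] on the left comes from. *)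
Lemma appellF1_diagonal (q : R) :
  q * appellF1 (3 / 2) 1 (1 / 2) 2 q (q ^ 2)
  = 2 * Series (fun m => Series (fun n =>
      (invsqrt_coeff (m + n + 1) * q ^ (m + n + 1)) * (invsqrt_coeff n * q ^ n))).
Proof.
unfold appellF1. rewrite <- !Series_scal_l. apply Series_ext; intros m.
rewrite <- !Series_scal_l. apply Series_ext; intros n.
unfold invsqrt_coeff. replace (m + n + 1)%nat with (S (m + n)) by lia.
rewrite <- (pochhammer_shift (1 / 2)), <- (pochhammer_one (S (m + n))).
rewrite <- (pochhammer_shift 1), pochhammer_one.
replace (1 / 2 + 1) with (3 / 2) by field. replace (1 + 1) with 2 by ring.
replace ((q ^ 2) ^ n) with (q ^ n * q ^ n)
  by (rewrite <- pow_mult, <- pow_add; f_equal; lia).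
rewrite <- tech_pow_Rmult, pow_add.
assert (Hpoch : pochhammer 2 (m + n) <> 0).
{ pose proof (pochhammer_shift 1 (m + n)) as E.
  replace (1 + 1) with 2 in E by ring.
  rewrite pochhammer_one in E. pose proof (INR_fact_neq_0 (S (m + n))).
  intros Z; rewrite Z in E; lra. }
pose proof (INR_fact_neq_0 m). pose proof (INR_fact_neq_0 n).
field. auto.
Qed.

(** * Parseval's formula for the even frequencies on a quarter period *)

Lemma is_RInt_cos_even (d : nat) : (0 < d)%nat ->
  is_RInt (fun x => cos (2 * INR d * x)) 0 (PI / 2) 0.
Proof.
intros Hd. apply lt_INR in Hd; simpl in Hd.
replace 0 with (minus (sin (2 * INR d * (PI / 2)) / (2 * INR d))
                      (sin (2 * INR d * 0) / (2 * INR d))) at 2.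
- apply (is_RInt_derive (fun x => sin (2 * INR d * x) / (2 * INR d))).
  + intros x _. auto_derive; [exact I|]. field. lra.
  + intros x _. apply continuous_comp; [|apply continuous_cos].
    apply (continuous_mult (K := R_AbsRing)); [apply continuous_const|apply continuous_id].
- unfold minus, plus, opp; simpl. rewrite Rmult_0_r, sin_0.
  replace (2 * INR d * (PI / 2)) with (IZR (Z.of_nat d) * PI)
    by (rewrite <- INR_IZR_INZ; field).
  rewrite (sin_eq_0_1 (IZR (Z.of_nat d) * PI)) by (now exists (Z.of_nat d)).
  field. lra.
Qed.

Definition cos_sum (w : nat -> R) (N : nat) (x : R) : R :=
  sum_f_R0 (fun n => w n * cos (2 * INR n * x)) N.
Definition sin_sum (w : nat -> R) (N : nat) (x : R) : R :=
  sum_f_R0 (fun n => w n * sin (2 * INR n * x)) N.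

(** Pairing cosine with cosine and sine with sine leaves only
    [cos (2 (L - n) x)]: the integrand is the real part of
    [e^(2iLx)] times the conjugate of [sum_n w_n e^(2inx)]. *)
Lemma is_RInt_orthogonal (w : nat -> R) (N L : nat) : (N < L)%nat ->
  is_RInt (fun x => cos (2 * INR L * x) * cos_sum w N x
                  + sin (2 * INR L * x) * sin_sum w N x) 0 (PI / 2) 0.
Proof.
intros HL.
assert (Hterm : forall n, (n < L)%nat ->
  is_RInt (fun x => cos (2 * INR L * x) * (w n * cos (2 * INR n * x))
                  + sin (2 * INR L * x) * (w n * sin (2 * INR n * x))) 0 (PI / 2) 0).
{ intros n Hn.
  apply is_RInt_ext with (fun x => scal (w n) (cos (2 * INR (L - n) * x))).
  - intros x _. rewrite minus_INR by lia.
    replace (2 * (INR L - INR n) * x) with (2 * INR L * x - 2 * INR n * x) by ring.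
    rewrite cos_minus. unfold scal; simpl; unfold mult; simpl. ring.
  - replace 0 with (scal (w n) 0) at 2 by (unfold scal; simpl; unfold mult; simpl; ring).
    apply (is_RInt_scal (V := R_NormedModule)), is_RInt_cos_even. lia. }
induction N as [|N IH].
- now apply Hterm.
- eapply is_RInt_ext; [|].
  2:{ replace 0 with (plus 0 0) at 2 by (unfold plus; simpl; ring).
      apply (is_RInt_plus (V := R_NormedModule)); [apply IH; lia | apply (Hterm (S N)); lia]. }
  intros x _. unfold cos_sum, sin_sum, plus; simpl. ring.
Qed.

Lemma is_RInt_finite_Parseval (w : nat -> R) (N : nat) :
  is_RInt (fun x => cos_sum w N x ^ 2 + sin_sum w N x ^ 2) 0 (PI / 2)
    (PI / 2 * sum_f_R0 (fun n => w n ^ 2) N).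
Proof.
assert (Hconst : forall c, is_RInt (fun _ => c) 0 (PI / 2) (PI / 2 * c)).
{ intros c. replace (PI / 2 * c) with (scal (PI / 2 - 0) c)
    by (unfold scal; simpl; unfold mult; simpl; ring).
  apply (is_RInt_const (V := R_NormedModule)). }
induction N as [|N IH].
- eapply is_RInt_ext; [|apply (Hconst (w 0%nat ^ 2))].
  intros x _. unfold cos_sum, sin_sum; simpl.
  replace (2 * 0 * x) with 0 by ring. rewrite cos_0, sin_0. ring.
- pose proof (is_RInt_orthogonal w N (S N) (Nat.lt_succ_diag_r N)) as Ho.
  apply (is_RInt_scal _ _ _ (2 * w (S N))) in Ho.
  pose proof (is_RInt_plus _ _ _ _ _ _ (is_RInt_plus _ _ _ _ _ _ IH Ho)
    (Hconst (w (S N) ^ 2))) as H.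
  replace (PI / 2 * sum_f_R0 (fun n => w n ^ 2) (S N)) with
    (plus (plus (PI / 2 * sum_f_R0 (fun n => w n ^ 2) N) (scal (2 * w (S N)) 0))
          (PI / 2 * w (S N) ^ 2))
    by (unfold plus, scal; simpl; unfold mult; simpl; ring).
  eapply is_RInt_ext; [|exact H].
  intros x _. set (t := 2 * INR (S N) * x).
  change (cos_sum w N x ^ 2 + sin_sum w N x ^ 2
    + 2 * w (S N) * (cos t * cos_sum w N x + sin t * sin_sum w N x) + w (S N) ^ 2
    = (cos_sum w N x + w (S N) * cos t) ^ 2 + (sin_sum w N x + w (S N) * sin t) ^ 2).
  replace (w (S N) ^ 2) with (w (S N) ^ 2 * (Rsqr (sin t) + Rsqr (cos t)))
    by (rewrite sin2_cos2; ring).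
  unfold Rsqr. ring.
Qed.

Lemma is_RInt_of_uniform_limit (F : nat -> R -> R) (f : R -> R) (e : nat -> R)
    (a b : R) (I : nat -> R) (l : R) : a <= b ->
  (forall N, is_RInt (F N) a b (I N)) -> ex_RInt f a b ->
  (forall N x, a <= x <= b -> Rabs (F N x - f x) <= e N) ->
  is_lim_seq e 0 -> is_lim_seq I l -> RInt f a b = l.
Proof.
intros Hab HF Hf He Hlim HI.
cut (is_lim_seq I (RInt f a b)).
{ intros H. apply is_lim_seq_unique in H. apply is_lim_seq_unique in HI.
  rewrite H in HI. now inversion HI. }
assert (Hd : forall N, Rabs (I N - RInt f a b) <= (b - a) * e N).
{ intros N.
  apply (norm_RInt_le_const (fun x => minus (F N x) (f x)) a b); auto.
  apply (is_RInt_minus (V := R_NormedModule)); auto.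
  now apply (RInt_correct (V := R_CompleteNormedModule)). }
assert (He0 : is_lim_seq (fun N => (b - a) * e N) 0).
{ replace (Finite 0) with (Rbar_mult (b - a) 0) by (simpl; f_equal; ring).
  now apply is_lim_seq_scal_l. }
revert Hd. generalize (RInt f a b). intros J Hd.
apply is_lim_seq_le_le with (fun N => J - (b - a) * e N) (fun N => J + (b - a) * e N).
- intros N. specialize (Hd N). apply Rabs_le_between in Hd. lra.
- replace (Finite J) with (Finite (J - 0)) by (f_equal; ring).
  apply is_lim_seq_minus'; [apply is_lim_seq_const|assumption].
- replace (Finite J) with (Finite (J + 0)) by (f_equal; ring).
  apply is_lim_seq_plus'; [apply is_lim_seq_const|assumption].
Qed.

(** * The modulus of the inverse square root on a circle *)

Lemma Rabs_cos_le x : Rabs (cos x) <= 1.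
Proof. apply Rabs_le, COS_bound. Qed.

Lemma Rabs_sin_le x : Rabs (sin x) <= 1.
Proof. apply Rabs_le, SIN_bound. Qed.

(** This is [|1 / (1 - z)| ^ 2 * |1 - z| ^ 2 = 1] for [z = r e^(2ix)]. Splitting off
    the first term of [G + i H = sum_n z^n] gives [G + i H = 1 + z (G + i H)], a
    real linear system for [G] and [H]; adding the squares of its two equations
    yields the claim. *)
Lemma geometric_modulus (r x : R) : Rabs r < 1 ->
  (Series (fun n => r ^ n * cos (2 * INR n * x)) ^ 2
   + Series (fun n => r ^ n * sin (2 * INR n * x)) ^ 2)
  * (1 - 2 * r * cos (2 * x) + r ^ 2) = 1.
Proof.
intros Hr.
pose (g := fun n => r ^ n * cos (2 * INR n * x)).
pose (h := fun n => r ^ n * sin (2 * INR n * x)).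
assert (Hg : ex_series g)
  by (apply ex_series_Rabs, ex_series_mul_bounded;
      [now apply ex_series_geom_abs | intros; apply Rabs_cos_le]).
assert (Hh : ex_series h)
  by (apply ex_series_Rabs, ex_series_mul_bounded;
      [now apply ex_series_geom_abs | intros; apply Rabs_sin_le]).
assert (EG : Series g = 1 + r * (cos (2 * x) * Series g - sin (2 * x) * Series h)).
{ rewrite Series_incr_1 at 1 by assumption. f_equal.
  - unfold g; simpl. replace (2 * 0 * x) with 0 by ring. rewrite cos_0; ring.
  - rewrite <- !Series_scal_l, <- Series_minus, <- Series_scal_l
      by now apply (ex_series_scal_l (V := R_NormedModule)).
    apply Series_ext; intros n. unfold g, h. rewrite S_INR.
    replace (2 * (INR n + 1) * x) with (2 * x + 2 * INR n * x) by ring.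
    rewrite cos_plus, <- tech_pow_Rmult. ring. }
assert (EH : Series h = r * (sin (2 * x) * Series g + cos (2 * x) * Series h)).
{ rewrite Series_incr_1 at 1 by assumption.
  replace (h 0%nat) with 0
    by (unfold h; simpl; replace (2 * 0 * x) with 0 by ring; rewrite sin_0; ring).
  rewrite Rplus_0_l.
  rewrite <- !Series_scal_l, <- Series_plus, <- Series_scal_l
      by now apply (ex_series_scal_l (V := R_NormedModule)).
  apply Series_ext; intros n. unfold g, h. rewrite S_INR.
  replace (2 * (INR n + 1) * x) with (2 * x + 2 * INR n * x) by ring.
  rewrite sin_plus, <- tech_pow_Rmult. ring. }
change ((Series g ^ 2 + Series h ^ 2) * (1 - 2 * r * cos (2 * x) + r ^ 2) = 1).
revert EG EH. generalize (Series g) (Series h). intros G H EG EH.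
pose proof (sin2_cos2 (2 * x)) as E1; unfold Rsqr in E1.
revert EG EH E1. generalize (cos (2 * x)) (sin (2 * x)). intros c s EG EH E1.
assert (E2 : G * (1 - r * c) + r * s * H = 1) by lra.
assert (E3 : H * (1 - r * c) - r * s * G = 0) by lra.
replace (1 - 2 * r * c + r ^ 2)
  with ((1 - r * c) ^ 2 + (r * s) ^ 2 + r ^ 2 * (1 - (s * s + c * c))) by ring.
rewrite E1.
transitivity ((G * (1 - r * c) + r * s * H) ^ 2 + (H * (1 - r * c) - r * s * G) ^ 2);
  [ring|]. rewrite E2, E3; ring.
Qed.

(** Real and imaginary parts of [(1 - z)^(-1/2)] at [z = r e^(2ix)]. *)
Definition invsqrt_cos (r x : R) : R :=
  Series (fun n => invsqrt_coeff n * r ^ n * cos (2 * INR n * x)).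
Definition invsqrt_sin (r x : R) : R :=
  Series (fun n => invsqrt_coeff n * r ^ n * sin (2 * INR n * x)).

Lemma invsqrt_real_part_sqr (r x : R) : Rabs r < 1 ->
  invsqrt_cos r x ^ 2 - invsqrt_sin r x ^ 2
  = Series (fun n => r ^ n * cos (2 * INR n * x)).
Proof.
intros Hr.
pose proof (is_series_invsqrt_mult r _ _ Hr
  (fun n => Rabs_cos_le (2 * INR n * x)) (fun n => Rabs_cos_le (2 * INR n * x))) as Hc.
pose proof (is_series_invsqrt_mult r _ _ Hr
  (fun n => Rabs_sin_le (2 * INR n * x)) (fun n => Rabs_sin_le (2 * INR n * x))) as Hs.
symmetry. unfold invsqrt_cos, invsqrt_sin. rewrite <- !Rsqr_pow2.
apply is_series_unique. eapply is_series_ext;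
  [|apply (is_series_minus (V := R_NormedModule) _ _ _ _ Hc Hs)].
intros N. cbn beta. change (@minus _ ?a ?b) with (Rminus a b).
change (@plus _ ?a (@opp _ ?b)) with (Rminus a b).
rewrite <- Rmult_minus_distr_l, <- minus_sum.
transitivity (r ^ N * sum_f_R0 (fun k =>
   invsqrt_coeff k * invsqrt_coeff (N - k) * cos (2 * INR N * x)) N).
- f_equal. apply sum_eq; intros i Hi; cbn beta. rewrite (minus_INR N i) by assumption.
  replace (2 * INR N * x)
    with (2 * INR i * x + 2 * (INR N - INR i) * x) by ring.
  rewrite cos_plus. ring.
- rewrite <- scal_sum, invsqrt_coeff_convolution. apply f_equal, Rmult_1_r.
Qed.

Lemma invsqrt_imag_part_sqr (r x : R) : Rabs r < 1 ->
  2 * (invsqrt_sin r x * invsqrt_cos r x)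
  = Series (fun n => r ^ n * sin (2 * INR n * x)).
Proof.
intros Hr.
pose proof (is_series_invsqrt_mult r _ _ Hr
  (fun n => Rabs_sin_le (2 * INR n * x)) (fun n => Rabs_cos_le (2 * INR n * x))) as Hsc.
pose proof (is_series_invsqrt_mult r _ _ Hr
  (fun n => Rabs_cos_le (2 * INR n * x)) (fun n => Rabs_sin_le (2 * INR n * x))) as Hcs.
symmetry. replace (2 * (invsqrt_sin r x * invsqrt_cos r x))
  with (invsqrt_sin r x * invsqrt_cos r x + invsqrt_cos r x * invsqrt_sin r x) by ring.
apply is_series_unique. eapply is_series_ext;
  [|apply (is_series_plus (V := R_NormedModule) _ _ _ _ Hsc Hcs)].
intros N. cbn beta. change (@plus _ ?a ?b) with (Rplus a b).
rewrite <- Rmult_plus_distr_l, <- plus_sum.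
transitivity (r ^ N * sum_f_R0 (fun k =>
   invsqrt_coeff k * invsqrt_coeff (N - k) * sin (2 * INR N * x)) N).
- f_equal. apply sum_eq; intros i Hi; cbn beta. rewrite (minus_INR N i) by assumption.
  replace (2 * INR N * x)
    with (2 * INR i * x + 2 * (INR N - INR i) * x) by ring.
  rewrite sin_plus. ring.
- rewrite <- scal_sum, invsqrt_coeff_convolution. apply f_equal, Rmult_1_r.
Qed.

(** For [W = C + i S] with [W ^ 2 = 1 / (1 - z)], one has
    [(C ^ 2 + S ^ 2) ^ 2 = (C ^ 2 - S ^ 2) ^ 2 + (2 S C) ^ 2 = 1 / |1 - z| ^ 2]. The
    right side below is the generating function of the Legendre polynomials at
    [cos (2 x)]. *)
Lemma invsqrt_modulus (r x : R) : Rabs r < 1 ->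
  invsqrt_cos r x ^ 2 + invsqrt_sin r x ^ 2
  = / sqrt (1 - 2 * r * cos (2 * x) + r ^ 2).
Proof.
intros Hr.
pose proof (geometric_modulus r x Hr) as H.
rewrite <- invsqrt_real_part_sqr, <- invsqrt_imag_part_sqr in H by assumption.
set (C := invsqrt_cos r x) in *. set (S := invsqrt_sin r x) in *.
set (d := 1 - 2 * r * cos (2 * x) + r ^ 2) in *.
assert (E : (C ^ 2 + S ^ 2) ^ 2 * d = 1) by (rewrite <- H; ring).
assert (Hn : 0 <= C ^ 2 + S ^ 2) by nra.
assert (Hd : d = / (C ^ 2 + S ^ 2) ^ 2).
{ apply Rmult_eq_reg_l with ((C ^ 2 + S ^ 2) ^ 2); [|intros Z; rewrite Z in E; lra].
  rewrite E, Rinv_r; [reflexivity|]. intros Z; rewrite Z in E; lra. }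
rewrite Hd, sqrt_inv, sqrt_pow2, Rinv_inv by assumption. reflexivity.
Qed.

(** * The integral of the Legendre generating function *)

Lemma Rabs_tail_le (w u : nat -> R) (m : nat) :
  ex_series (fun n => Rabs (w n)) -> (forall n, Rabs (u n) <= 1) ->
  Rabs (tail (fun n => w n * u n) m) <= tail (fun n => Rabs (w n)) m.
Proof.
intros Hw Hu. unfold tail.
assert (Hwm : ex_series (fun k => Rabs (w (m + k)%nat)))
  by now apply (ex_series_incr_n (V := R_NormedModule) (fun n => Rabs (w n))).
assert (Hle : forall k, 0 <= Rabs (w (m + k)%nat * u (m + k)%nat) <= Rabs (w (m + k)%nat)).
{ intros k; split; [apply Rabs_pos|]. rewrite Rabs_mult.
  rewrite <- (Rmult_1_r (Rabs (w _))) at 2.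
  apply Rmult_le_compat_l; [apply Rabs_pos|auto]. }
eapply Rle_trans; [apply Series_Rabs | now apply Series_le].
apply ex_series_mul_bounded; auto.
Qed.

(** The bound does not depend on [u], hence it is uniform in [x] for the
    trigonometric series: it lets Parseval's formula pass to the limit. *)
Lemma partial_sum_sqr_dist (w u : nat -> R) (N : nat) :
  ex_series (fun n => Rabs (w n)) -> (forall n, Rabs (u n) <= 1) ->
  Rabs (sum_f_R0 (fun n => w n * u n) N ^ 2 - Series (fun n => w n * u n) ^ 2)
  <= 3 * tail (fun n => Rabs (w n)) 0 * tail (fun n => Rabs (w n)) (S N).
Proof.
intros Hw Hu.
assert (Hex : ex_series (fun n => w n * u n))
  by now apply ex_series_Rabs, ex_series_mul_bounded.
pose proof (Rabs_tail_le w u 0 Hw Hu) as H0.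
pose proof (Rabs_tail_le w u (S N) Hw Hu) as HN.
change (tail (fun n => w n * u n) 0) with (Series (fun n => w n * u n)) in H0.
rewrite <- sum_n_tail, sum_n_Reals in HN by assumption.
pose proof (tail_le _ 0 (S N) (fun n => Rabs_pos (w n)) Hw (Nat.le_0_l _)) as Hmono.
revert H0 HN Hmono.
generalize (tail (fun n => Rabs (w n)) 0) (tail (fun n => Rabs (w n)) (S N))
  (Series (fun n => w n * u n)) (sum_f_R0 (fun n => w n * u n) N).
intros P e A B H0 HN Hmono.
replace (B ^ 2 - A ^ 2) with ((A - B) * ((A - B) - 2 * A)) by ring.
rewrite Rabs_mult.
assert (Rabs (A - B - 2 * A) <= 3 * P).
{ eapply Rle_trans; [apply Rabs_triang|]. rewrite Rabs_Ropp, Rabs_mult, (Rabs_pos_eq 2); lra. }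
rewrite Rmult_comm. apply Rmult_le_compat; auto using Rabs_pos.
Qed.

Lemma legendre_kernel_pos (r x : R) : Rabs r < 1 ->
  0 < 1 - 2 * r * cos (2 * x) + r ^ 2.
Proof.
intros Hr. apply Rabs_lt_between in Hr.
pose proof (sin2_cos2 (2 * x)) as E; unfold Rsqr in E.
pose proof (COS_bound (2 * x)). revert E H.
generalize (cos (2 * x)) (sin (2 * x)); intros c s E H.
replace (1 - 2 * r * c + r ^ 2)
  with ((1 - r * c) ^ 2 + (r * s) ^ 2 + r ^ 2 * (1 - (s * s + c * c))) by ring.
rewrite E. assert (r * c < 1) by nra. nra.
Qed.

Lemma ex_RInt_legendre_kernel (r a b : R) : Rabs r < 1 ->
  ex_RInt (fun x => / sqrt (1 - 2 * r * cos (2 * x) + r ^ 2)) a b.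
Proof.
intros Hr. apply (ex_RInt_continuous (V := R_CompleteNormedModule)). intros x _.
pose proof (legendre_kernel_pos r x Hr) as Hpos.
apply (ex_derive_continuous (V := R_NormedModule)). auto_derive.
change (r * (r * 1)) with (r ^ 2). repeat split; try exact Hpos.
apply Rgt_not_eq, sqrt_lt_R0, Hpos.
Qed.

(** The kernel is the uniform limit of [|sum_(n <= N) a_n z^n| ^ 2], whose integrals
    are the partial sums of the right side. *)
Lemma RInt_legendre_kernel (r : R) : Rabs r < 1 ->
  RInt (fun x => / sqrt (1 - 2 * r * cos (2 * x) + r ^ 2)) 0 (PI / 2)
  = PI / 2 * Series (fun n => (invsqrt_coeff n * r ^ n) ^ 2).
Proof.
intros Hr.
set (w := fun n => invsqrt_coeff n * r ^ n).
assert (Hw : ex_series (fun n => Rabs (w n))) by now apply ex_series_invsqrt.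
assert (Hw0 : is_lim_seq (tail (fun n => Rabs (w n))) 0) by now apply is_lim_seq_tail.
pose (P := tail (fun n => Rabs (w n)) 0).
apply (is_RInt_of_uniform_limit (fun N x => cos_sum w N x ^ 2 + sin_sum w N x ^ 2) _
  (fun N => 6 * P * tail (fun n => Rabs (w n)) (S N)) _ _
  (fun N => PI / 2 * sum_f_R0 (fun n => w n ^ 2) N)).
- pose proof PI_RGT_0; lra.
- intros N; apply is_RInt_finite_Parseval.
- now apply ex_RInt_legendre_kernel.
- intros N x _. rewrite <- invsqrt_modulus by assumption.
  replace (cos_sum w N x ^ 2 + sin_sum w N x ^ 2 - (invsqrt_cos r x ^ 2 + invsqrt_sin r x ^ 2))
    with ((cos_sum w N x ^ 2 - invsqrt_cos r x ^ 2) + (sin_sum w N x ^ 2 - invsqrt_sin r x ^ 2))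
    by ring.
  eapply Rle_trans; [apply Rabs_triang|].
  pose proof (partial_sum_sqr_dist w _ N Hw (fun n => Rabs_cos_le (2 * INR n * x))).
  pose proof (partial_sum_sqr_dist w _ N Hw (fun n => Rabs_sin_le (2 * INR n * x))).
  unfold cos_sum, sin_sum, invsqrt_cos, invsqrt_sin, P. unfold w in *. lra.
- replace (Finite 0) with (Rbar_mult (6 * P) 0) by (simpl; f_equal; ring).
  apply is_lim_seq_scal_l. now apply is_lim_seq_incr_1 in Hw0.
- apply (is_lim_seq_scal_l _ (PI / 2) (Series (fun n => w n ^ 2))).
  apply is_lim_seq_ext with (sum_n (fun n => w n ^ 2)); [intros; apply sum_n_Reals|].
  now apply (Series_correct (fun n => w n ^ 2)), ex_series_sqr.
Qed.

(** * The complete elliptic integral *)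

Lemma trig_integrand_pos (k x : R) : k ^ 2 < 1 -> 0 < 1 - k ^ 2 * sin x ^ 2.
Proof.
intros Hk. pose proof (sin2_cos2 x) as E; unfold Rsqr in E.
pose proof (pow2_ge_0 k). pose proof (pow2_ge_0 (sin x)).
pose proof (pow2_ge_0 (cos x)).
nra.
Qed.

(** The substitution [x = sin t] is used on [0, y] with [y < PI / 2], away from the
    singular endpoint, so that only proper integrals are compared. *)
Lemma is_RInt_ellipticK_sub (k y : R) : k ^ 2 < 1 -> 0 <= y < PI / 2 ->
  is_RInt (fun x => / sqrt ((1 - x ^ 2) * (1 - k ^ 2 * x ^ 2))) 0 (sin y)
    (RInt (fun t => / sqrt (1 - k ^ 2 * sin t ^ 2)) 0 y).
Proof.
intros Hk Hy.
set (f := fun x => / sqrt ((1 - x ^ 2) * (1 - k ^ 2 * x ^ 2))).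
assert (Hsy : 0 <= sin y < 1).
{ split; [apply sin_ge_0; lra|]. rewrite <- sin_PI2. apply sin_increasing_1; lra. }
assert (Hf : forall x, 0 <= x < 1 -> continuous f x).
{ intros x Hx. assert (H : 0 < (1 - x ^ 2) * (1 - k ^ 2 * x ^ 2)).
  { pose proof (pow2_ge_0 k). apply Rmult_lt_0_compat; nra. }
  apply (ex_derive_continuous (V := R_NormedModule)). unfold f. auto_derive.
  change (x * (x * 1)) with (x ^ 2). change (k * (k * 1)) with (k ^ 2).
  split; [exact H|]. split; [|exact I]. apply Rgt_not_eq, sqrt_lt_R0, H. }
assert (Hint : ex_RInt f 0 (sin y)).
{ apply (ex_RInt_continuous (V := R_CompleteNormedModule)). intros x Hx.
  rewrite Rmin_left, Rmax_right in Hx by lra. apply Hf; lra. }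
assert (Hcomp : is_RInt (fun t => scal (cos t) (f (sin t))) 0 y (RInt f (sin 0) (sin y))).
{ apply (is_RInt_comp (V := R_CompleteNormedModule)); rewrite Rmin_left, Rmax_right by lra.
  - intros x Hx. apply Hf. split; [apply sin_ge_0; lra|].
    rewrite <- sin_PI2. apply sin_increasing_1; lra.
  - intros x Hx. split; [|apply continuous_cos].
    apply is_derive_Reals, derivable_pt_lim_sin. }
rewrite sin_0 in Hcomp.
replace (RInt (fun t => / sqrt (1 - k ^ 2 * sin t ^ 2)) 0 y) with (RInt f 0 (sin y)).
- now apply (RInt_correct (V := R_CompleteNormedModule)).
- symmetry. apply is_RInt_unique. eapply is_RInt_ext; [|exact Hcomp].
  intros t Ht. rewrite Rmin_left, Rmax_right in Ht by lra.
  assert (Hc : 0 < cos t) by (apply cos_gt_0; lra).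
  pose proof (trig_integrand_pos k t Hk) as Hd.
  unfold f, scal; simpl; unfold mult; simpl.
  change (sin t * (sin t * 1)) with (sin t ^ 2).
  change (k * (k * 1)) with (k ^ 2).
  replace (1 - sin t ^ 2) with (cos t ^ 2)
    by (pose proof (sin2_cos2 t) as E; unfold Rsqr in E; lra).
  rewrite sqrt_mult, sqrt_pow2 by (try apply pow2_ge_0; lra).
  apply sqrt_lt_R0 in Hd. field. split; lra.
Qed.

(** After the substitution nothing is singular at [PI / 2], and the improper integral
    converges because the proper one is continuous in its upper endpoint. *)
Lemma ellipticK_trig (k : R) : k ^ 2 < 1 ->
  ellipticK k = RInt (fun t => / sqrt (1 - k ^ 2 * sin t ^ 2)) 0 (PI / 2).
Proof.
intros Hk. set (g := fun t => / sqrt (1 - k ^ 2 * sin t ^ 2)).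
pose proof PI_RGT_0 as Hpi.
assert (Hg : forall t, continuous g t).
{ intros t. pose proof (trig_integrand_pos k t Hk) as H.
  apply (ex_derive_continuous (V := R_NormedModule)). unfold g. auto_derive.
  change (sin t * (sin t * 1)) with (sin t ^ 2). change (k * (k * 1)) with (k ^ 2).
  split; [exact H|]. split; [|exact I]. apply Rgt_not_eq, sqrt_lt_R0, H. }
assert (HG : continuous (fun y => RInt g 0 y) (PI / 2)).
{ apply (ex_derive_continuous (V := R_NormedModule)). exists (g (PI / 2)).
  apply (is_derive_RInt (V := R_NormedModule) g _ 0); auto.
  exists (mkposreal 1 Rlt_0_1). intros y _.
  apply (RInt_correct (V := R_CompleteNormedModule)).
  apply (ex_RInt_continuous (V := R_CompleteNormedModule)). auto. }
unfold ellipticK. apply is_RInt_gen_unique; try typeclasses eauto.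
intros P HP.
destruct (HG P HP) as [d Hd].
(* If sin (PI/2 - e) < x < 1 then asin x lies within e of PI/2; the minimum keeps
   PI/2 - e in the range where sin is increasing and nonnegative. *)
pose (e := Rmin d (PI / 2)).
assert (He : 0 < e <= PI / 2).
{ unfold e; split; [apply Rmin_pos; [apply cond_pos|lra]|apply Rmin_r]. }
assert (Hed : e <= d) by apply Rmin_l.
pose (x0 := sin (PI / 2 - e)).
assert (Hx0 : 0 <= x0 < 1).
{ unfold x0; split; [apply sin_ge_0; lra|].
  rewrite <- sin_PI2. apply sin_increasing_1; lra. }
apply Filter_prod with (fun a => a = 0) (fun x => x0 < x < 1).
- reflexivity.
- assert (Hp : 0 < 1 - x0) by lra. exists (mkposreal _ Hp). intros x Hx Hx1.
  unfold ball in Hx; simpl in Hx. unfold AbsRing_ball, abs, minus, plus, opp in Hx; simpl in Hx.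
  apply Rabs_lt_between in Hx. lra.
- intros a x -> Hx. simpl.
  assert (Hb : - (PI / 2) < asin x < PI / 2) by (apply asin_bound_lt; lra).
  assert (Es : sin (asin x) = x) by (apply sin_asin; lra).
  assert (Hlow : PI / 2 - e < asin x).
  { apply sin_increasing_0; try lra. rewrite Es. apply Hx. }
  exists (RInt g 0 (asin x)). split.
  + rewrite <- Es at 1. apply is_RInt_ellipticK_sub; auto. lra.
  + apply Hd. unfold ball; simpl. unfold AbsRing_ball, abs, minus, plus, opp; simpl.
    apply Rabs_lt_between. lra.
Qed.

Lemma ellipticK_landen_series (k q : R) : 0 <= q < 1 -> k ^ 2 = 4 * q / (1 + q) ^ 2 ->
  ellipticK k
  = (1 + q) * (PI / 2 * Series (fun n => (invsqrt_coeff n * q ^ n) ^ 2)).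
Proof.
intros Hq Hk.
assert (Hk1 : k ^ 2 < 1).
{ assert (0 < (1 - q) ^ 2) by nra.
  rewrite Hk. apply Rmult_lt_reg_r with ((1 + q) ^ 2); [nra|].
  unfold Rdiv. rewrite Rmult_assoc, Rinv_l by nra. nra. }
assert (Hr : Rabs (- q) < 1) by (rewrite Rabs_Ropp, Rabs_pos_eq; lra).
rewrite ellipticK_trig by assumption.
(* The kernel needs the sign - q, which the squares in the series do not see. *)
rewrite (Series_ext _ (fun n => (invsqrt_coeff n * (- q) ^ n) ^ 2)).
2:{ intros n. rewrite !Rpow_mult_distr, <- !pow_mult, !(Nat.mul_comm n 2), !pow_mult.
    f_equal. f_equal. ring. }
rewrite <- RInt_legendre_kernel by assumption.
symmetry. rewrite <- (RInt_scal (V := R_CompleteNormedModule)).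
- apply RInt_ext. intros x _.
  unfold scal; simpl; unfold mult; simpl.
  pose proof (legendre_kernel_pos (- q) x Hr) as Hpos.
  pose proof (trig_integrand_pos k x Hk1) as Hd.
  change (1 - 2 * - q * cos (2 * x) + - q * (- q * 1))
    with (1 - 2 * - q * cos (2 * x) + (- q) ^ 2).
  change (1 - k * (k * 1) * (sin x * (sin x * 1))) with (1 - k ^ 2 * sin x ^ 2).
  replace (1 - 2 * - q * cos (2 * x) + (- q) ^ 2)
    with ((1 + q) ^ 2 * (1 - k ^ 2 * sin x ^ 2)).
  2:{ rewrite Hk, cos_2a_sin. field. lra. }
  rewrite sqrt_mult, sqrt_pow2 by (try apply pow2_ge_0; lra).
  apply sqrt_lt_R0 in Hd. field. split; lra.
- now apply ex_RInt_legendre_kernel.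
Qed.

(** * The formula for pi *)

Theorem corollary4p2 (b : R) (hb : 1 < b) :
  PI = 2 * b ^ 4 * (b ^ 2 - 1) / (1 + b ^ 2) *
       (ellipticK (2 * b / (1 + b ^ 2)) /
        (b ^ 4 + (1 - b ^ 2) *
           appellF1 (3 / 2) 1 (1 / 2) 2 (1 / b ^ 2) (1 / b ^ 4))).
Proof.
set (q := 1 / b ^ 2).
assert (Hb2 : 1 < b ^ 2) by nra.
assert (Eb : b ^ 2 * q = 1) by (unfold q; field; lra).
assert (Hq : 0 < q < 1) by (split; nra).
assert (Hq' : Rabs q < 1) by (rewrite Rabs_pos_eq; lra).
replace (1 / b ^ 4) with (q ^ 2) by (unfold q; field; lra).
rewrite (ellipticK_landen_series _ q).
2: lra.
2:{ unfold q. field. split; [lra|nra]. }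
set (p := fun n => invsqrt_coeff n * q ^ n).
assert (Hp0 : forall n, 0 <= p n).
{ intros n. pose proof (invsqrt_coeff_bounds n).
  apply Rmult_le_pos; [lra|apply pow_le; lra]. }
pose proof (ex_series_invsqrt q Hq') as Hp.
pose proof (Series_sqr_diagonals p Hp0 (ex_series_Rabs _ Hp)) as HS.
unfold p in HS at 1 3 4.
rewrite invsqrt_series_sqr, <- appellF1_diagonal in HS by assumption.
assert (Hpos : 0 < Series (fun n => p n ^ 2)).
{ change (0 < tail (fun n => p n ^ 2) 0).
  rewrite tail_S by now apply ex_series_sqr.
  pose proof (tail_nonneg _ 1 (fun n => pow2_ge_0 (p n)) (ex_series_sqr _ Hp)).
  assert (E0 : p 0%nat = 1) by (unfold p, invsqrt_coeff; simpl; field).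
  rewrite E0. lra. }
change (Series (fun n => (invsqrt_coeff n * q ^ n) ^ 2)) with (Series (fun n => p n ^ 2)).
revert HS Hpos. generalize (Series (fun n => p n ^ 2)).
generalize (appellF1 (3 / 2) 1 (1 / 2) 2 q (q ^ 2)). intros F S HS Hpos.
assert (Hden : b ^ 4 + (1 - b ^ 2) * F = b ^ 4 * ((1 - q) * S)).
{ assert (E1 : (1 - q) * (S + q * F) = 1) by (rewrite <- HS; field; lra).
  replace (b ^ 4) with (b ^ 2 * b ^ 2) by ring.
  replace (b ^ 2) with (/ q) by (unfold q; field; lra).
  replace ((1 - q) * S) with (1 - (1 - q) * (q * F)) by lra. field. lra. }
rewrite Hden. unfold q. field. repeat split; nra.
Qed.
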